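(* Let $n\ge 1$, let $a=(a_1,\ldots,a_n)$ and $b=(b_1,\ldots,b_n)$ be two $n$-tuples of positive integers, and let $X$ be a non-empty subset of $\mathbb{N}\setminus\{0\}$. Then the following conditions are equivalent. 1. $\mathcal{N}(a,b,X)$ is finite. 2. $M(a,b,X)$ is a numerical semigroup. 3. $\gcd(X\cup\{b_1,\ldots,b_n\})=1$.
   Context: $\mathbb{N}$ is the set of non-negative integers. A numerical semigroup is a submonoid $S$ of $(\mathbb{N},+)$ with $\mathbb{N}\setminus S$ finite. For $s\in\mathbb{N}$, $as+b=(a_1s+b_1,\ldots,a_ns+b_n)$. $\mathcal{N}(a,b,X)$ is the set of all numerical semigroups $S$ such that $X\subseteq S$ and $as+b\in S^n$ for all $s\in S\setminus\{0\}$. $M(a,b,X)=\bigcap_{S\in\mathcal{N}(a,b,X)}S$. For a (possibly infinite) set $A$ of integers, $\gcd(A)$ is the greatest common divisor of the elements of $A$. *)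

(* Defs.v *)
From mathcomp Require Import all_boot.
From mathcomp Require Import boolp classical_sets functions cardinality.

Set Implicit Arguments.
Unset Strict Implicit.
Unset Printing Implicit Defensive.

Local Open Scope classical_set_scope.
Local Open Scope nat_scope.

Definition numerical_semigroup (S : set nat) : Prop :=
  [/\ S 0, forall x y, S x -> S y -> S (x + y) & finite_set (~` S)].

Definition affine_tuple (n : nat) (a b : n.-tuple nat) (s : nat) :
  n.-tuple nat := [tuple tnth a i * s + tnth b i | i < n].

Definition tuple_power (n : nat) (S : set nat) : set (n.-tuple nat) :=
  [set t | forall i : 'I_n, S (tnth t i)].

Definition semigroup_family (n : nat) (a b : n.-tuple nat) (X : set nat) :
  set (set nat) :=
  [set S | [/\ numerical_semigroup S, X `<=` S &
      forall s, (S `\ 0) s -> tuple_power S (affine_tuple a b s)]].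

Definition semigroup_meet (n : nat) (a b : n.-tuple nat) (X : set nat) :
  set nat := \bigcap_(S in semigroup_family a b X) S.

(* "Greatest" is meant for divisibility, so that d is uniquely determined by A,
   also when A is infinite. *)
Definition is_gcd (A : set nat) (d : nat) : Prop :=
  (forall x, A x -> d %| x) /\
  (forall e, (forall x, A x -> e %| x) -> e %| d).

(* Main.v *)
(* M = M(a,b,X) is itself closed under addition and under s |-> a_i s + b_i, so
   any common divisor of M divides X and hence, applying this map to an element
   of X, every b_i. If gcd(X, b) = 1, then M is a submonoid of gcd 1, hence
   cofinite. Conversely, if d divides X and every b_i, then dN together with
   [N, oo) belongs to the family for every N, so M lies in dN. Finally, a
   cofinite M has finitely many supersets, and a finite intersection of
   cofinite sets is cofinite. *)
Require Import Defs.
From mathcomp Require Import all_boot.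
From mathcomp Require Import boolp classical_sets functions cardinality.

Local Open Scope classical_set_scope.
Local Open Scope nat_scope.

Lemma finite_setC_natP (S : set nat) :
  finite_set (~` S) <-> exists N, forall m, N <= m -> S m.
Proof.
split=> [/finite_seqP[s sE]|[N NS]].
  exists (\max_(i <- s) i).+1 => m lt_m.
  apply: contrapT => nSm.
  have ms : m \in s by have : (~` S) m by []; rewrite sE.
  by have := @leq_bigmax_seq _ s xpredT id m ms isT; rewrite leqNgt lt_m.
apply: (@sub_finite_set _ _ `I_N); last exact: finite_II.
move=> m nSm /=; rewrite ltnNge; apply/negP => /NS; exact: nSm.
Qed.

(** A superset of [M] is determined by its trace on the integers below [N], where [M] contains
    everything from [N] on. The map [f] rebuilds it from this trace. *)
Lemma finite_supersets (M : set nat) :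
  finite_set (~` M) -> finite_set [set S | M `<=` S].
Proof.
move=> /finite_setC_natP[N NM].
pose f (A : {set 'I_N}) : set nat :=
  [set k | N <= k \/ exists2 i : 'I_N, i \in A & k = i].
apply: (@sub_finite_set _ _ (f @` setT)); last first.
  by apply: finite_image; exact: finite_finset.
move=> S MS; exists [set i : 'I_N | `[< S i >]]%SET => //.
apply/seteqP; split=> k /=.
  by move=> [/NM /MS //|[i]]; rewrite inE => /asboolP Si ->.
move=> Sk; case: (leqP N k) => [|ltk]; [by left|right].
by exists (Ordinal ltk) => //; rewrite inE; apply/asboolP.
Qed.

Section Submonoid.
Variable S : set nat.
Hypotheses (S0 : S 0) (SD : forall x y, S x -> S y -> S (x + y)).

Lemma submonoid_muln k x : S x -> S (k * x).
Proof. by move=> Sx; elim: k => // k IHk; rewrite mulSn; apply: SD. Qed.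

(* The least positive difference of two elements of [S] divides every element
   of [S], hence is 1. *)
Lemma submonoid_consecutive (x : nat) : S x -> 0 < x ->
  (forall d, (forall y, S y -> d %| y) -> d = 1) -> exists2 s, S s & S s.+1.
Proof.
move=> Sx x_gt0 gcd1.
pose P d := `[< 0 < d /\ exists2 s, S s & S (s + d) >].
have exP : exists d, P d.
  by exists x; apply/asboolP; split=> //; exists 0.
case: (ex_minnP exP) => d /asboolP[d_gt0 [s Ss Ssd]] dmin.
suff d1 : d = 1 by exists s => //; rewrite -addn1 -d1.
apply: gcd1 => t St; rewrite /dvdn -leqn0 leqNgt; apply/negP => r_gt0.
have /dmin : P (t %% d).
  (* With [t = q * d + r], the elements [q * (s + d)] and [q * s + t] of [S] differ by [r]. *)
  apply/asboolP; split=> //; exists (t %/ d * (s + d)).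
    exact: submonoid_muln.
  rewrite mulnDr -addnA -divn_eq; apply: SD => //; exact: submonoid_muln.
by rewrite leqNgt ltn_mod d_gt0.
Qed.

(** For consecutive [s], [s.+1] in [S] and [m = q * s + r] with [r < s], one has
    [m = (q - r) * s + r * s.+1] as soon as [r <= q], which [s * s <= m] ensures. *)
Lemma submonoid_cofinite (x : nat) : S x -> 0 < x ->
  (forall d, (forall y, S y -> d %| y) -> d = 1) -> finite_set (~` S).
Proof.
move=> Sx x_gt0 gcd1.
have [s Ss Ss1] := submonoid_consecutive _ Sx x_gt0 gcd1.
apply/finite_setC_natP; exists (s * s) => m le_m.
have [s0|s_gt0] := posnP s.
  (* Here [s.+1] is 1, which generates all of [nat]. *)
  by rewrite -[m]muln1; apply: submonoid_muln; rewrite s0 in Ss1.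
have le_rq : m %% s <= m %/ s.
  by rewrite (leq_trans (ltnW (ltn_pmod m s_gt0))) // leq_divRL.
have -> : m = (m %/ s - m %% s) * s + m %% s * s.+1.
  by rewrite mulnS addnCA -mulnDl subnK // addnC -divn_eq.
by apply: SD; apply: submonoid_muln.
Qed.

End Submonoid.

Lemma numerical_semigroup_consecutive {S : set nat} :
  numerical_semigroup S -> exists2 s, S s & S s.+1.
Proof.
move=> [_ _ /finite_setC_natP[N NS]].
by exists N; apply: NS.
Qed.

Section Family.
Variables (n : nat) (a b : n.-tuple nat) (X : set nat).

Lemma semigroup_meet0 : semigroup_meet a b X 0.
Proof. by move=> S [[]]. Qed.

Lemma semigroup_meetD x y : semigroup_meet a b X x ->
  semigroup_meet a b X y -> semigroup_meet a b X (x + y).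
Proof.
by move=> Mx My S NS; have [[_ SD _] _ _] := NS; apply: SD; [apply: Mx|apply: My].
Qed.

Lemma sub_semigroup_meet : X `<=` semigroup_meet a b X.
Proof. by move=> x Xx S [_ XS _]; apply: XS. Qed.

Lemma semigroup_meet_affine s i : semigroup_meet a b X s -> s <> 0 ->
  semigroup_meet a b X (tnth a i * s + tnth b i).
Proof.
move=> Ms s0 S NS; have [_ _ /(_ s)] := NS.
by move=> /(_ (conj (Ms _ NS) s0)) /(_ i); rewrite tnth_mktuple.
Qed.

Lemma semigroup_meet_finite :
  finite_set (semigroup_family a b X) <->
  numerical_semigroup (semigroup_meet a b X).
Proof.
split=> [fin|[_ _ finM]].
  split; [exact: semigroup_meet0|exact: semigroup_meetD|].
  rewrite /semigroup_meet setC_bigcap.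
  by apply: bigcup_finite => // S [[]].
apply: sub_finite_set (finite_supersets _ finM) => S NS m; exact.
Qed.

(** The affine maps preserve multiples of [d] because [d] divides each [b_i], and preserve the tail
    from [N] on because [a_i > 0] gives [s <= a_i * s + b_i]. *)
Lemma multiples_or_large_family (d N : nat) :
  (forall i, 0 < tnth a i) -> (forall i, d %| tnth b i) ->
  (forall x, X x -> d %| x) ->
  semigroup_family a b X [set m | d %| m \/ N <= m].
Proof.
move=> a_gt0 db dX; split.
- split; first by left; rewrite dvdn0.
    move=> x y [dx|Nx] [dy|Ny]; [by left; apply: dvdn_add| | |]; right.
    + exact: leq_trans Ny (leq_addl _ _).
    + exact: leq_trans Nx (leq_addr _ _).
    + exact: leq_trans Nx (leq_addr _ _).
  by apply/finite_setC_natP; exists N => m; right.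
- by move=> x /dX; left.
- move=> s [ds _] i; rewrite tnth_mktuple.
  case: ds => [ds|Ns]; [left; apply: dvdn_add => //; exact: dvdn_mull|right].
  by rewrite (leq_trans Ns) // (leq_trans (leq_pmull _ (a_gt0 i))) ?leq_addr.
Qed.

Lemma dvdn_semigroup_meet (d : nat) :
  (forall i, 0 < tnth a i) -> (forall i, d %| tnth b i) ->
  (forall x, X x -> d %| x) ->
  forall m, semigroup_meet a b X m -> d %| m.
Proof.
move=> a_gt0 db dX m Mm.
(* Starting the tail at [m.+1] excludes [m] from it, so [m] must be a multiple of [d]. *)
have [//|] := Mm _ (multiples_or_large_family d m.+1 a_gt0 db dX).
by rewrite ltnn.
Qed.

End Family.

Theorem theorem2p6 (n : nat) (hn : 1 <= n) (a b : n.-tuple nat)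
  (ha : forall i : 'I_n, 0 < tnth a i) (hb : forall i : 'I_n, 0 < tnth b i)
  (X : set nat) (hX0 : X !=set0) (hX : X `<=` ~` [set 0]) :
  (finite_set (semigroup_family a b X) <->
     numerical_semigroup (semigroup_meet a b X)) /\
  (numerical_semigroup (semigroup_meet a b X) <->
     is_gcd (X `|` range (tnth b)) 1).
Proof.
split; first exact: semigroup_meet_finite.
split=> [nsM|[_ gcd1]].
  split=> [x _|d dA]; first exact: dvd1n.
  have dM : forall m, semigroup_meet a b X m -> d %| m.
    apply: dvdn_semigroup_meet => // [i|x Xx]; apply: dA; last by left.
    by right; exists i.
  (* A common divisor of two consecutive elements divides 1. *)
  have [s /dM ds /dM] := numerical_semigroup_consecutive nsM.
  by rewrite -addn1 dvdn_addr.
have [x Xx] := hX0.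
have Mx : semigroup_meet a b X x by apply: sub_semigroup_meet.
split; [exact: semigroup_meet0|exact: semigroup_meetD|].
apply: (submonoid_cofinite _ _ _ _ Mx).
- exact: semigroup_meet0.
- exact: semigroup_meetD.
- by rewrite lt0n; apply/eqP; apply: hX.
move=> d dM; apply/eqP; rewrite -dvdn1; apply: gcd1 => y [Xy|[i _ <-]].
  by apply: dM; apply: sub_semigroup_meet.
have /dM := semigroup_meet_affine _ _ _ _ _ i Mx (hX _ Xx).
by rewrite dvdn_addr // dvdn_mull // dM.
Qed.
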